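(* Consider a network $\dot{x}_i=f(x_i)+u_i$, $i=1,\dots,N$, $x_i\in\mathbb{R}^n$, with $u_i$ depending on $x_1,\dots,x_N$. Suppose there is a smooth $\Phi:(\mathbb{R}^n)^N\times(\mathbb{R}^n)^N\to\mathbb{R}^n$ such that for every $i=1,\dots,N$, $$\Phi(x_i,x_{i+1},\dots,x_{i+N-1},x_1,\dots,x_N)=f(x_i)+u_i,$$ with indices taken modulo $N$. Define $\Psi:\mathbb{R}^{nN}\times(\mathbb{R}^n)^N\to\mathbb{R}^{nN}$ by, for $Y=(y_1,\dots,y_N)\in(\mathbb{R}^n)^N$, letting the $k$-th $n$-block of $\Psi(Y,x_1,\dots,x_N)$ be $\Phi(y_k,y_{k+1},\dots,y_{k+N-1},x_1,\dots,x_N)$ (indices mod $N$). Let $(x_1(t),\dots,x_N(t))$ be a solution of the network and suppose there is $\lambda>0$ with $\big(\tfrac{\partial\Psi}{\partial Y}(Y,x_1(t),\dots,x_N(t))\big)_s\preceq-\lambda I$ for all $Y\in\mathbb{R}^{nN}$ and $t\ge0$. Then $\|x_i(t)-x_j(t)\|\to0$ exponentially as $t\to\infty$ for all $i,j$. In particular, if this holds for every solution, the network is completely synchronized regardless of initial conditions.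
   Context: For a square matrix $M$, $M_s=\tfrac12(M+M^T)$. $M\preceq N$ means $N-M$ is positive semidefinite. *)

(* Defs.v *)
From HB Require Import structures.
From mathcomp Require Import all_boot all_order all_algebra.
From mathcomp Require Import all_classical all_reals all_analysis.
Set Implicit Arguments. Unset Strict Implicit. Unset Printing Implicit Defensive.
Import Order.TTheory GRing.Theory Num.Theory.
Import numFieldNormedType.Exports.
Local Open Scope ring_scope.

Lemma cshift_proof (N : nat) (k i : 'I_N) : ((k + i) %% N < N)%N.
Proof. by rewrite ltn_pmod // (leq_ltn_trans (leq0n k) (ltn_ord k)). Qed.
Definition cshift (N : nat) (k i : 'I_N) : 'I_N := Ordinal (cshift_proof k i).

(* (y_k, y_{k+1}, ..., y_{k+N-1}) (indices mod N), as the N x n matrix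
   whose i-th row is y_{k+i}; Y has rows y_0, ..., y_{N-1}. *)
Definition cyc {R : Type} (N n : nat) (k : 'I_N) (Y : 'M[R]_(N, n)) : 'M[R]_(N, n) :=
  \matrix_(i < N, j < n) Y (cshift k i) j.

Fixpoint Ck {R : realType} {V W : normedModType R} (k : nat) (g : V -> W) : Prop :=
  match k with
  | 0 => continuous g
  | k'.+1 => (forall x v, derivable g x v) /\ (forall v, Ck k' (fun x => 'D_v g x))
  end.
Definition smooth {R : realType} {V W : normedModType R} (g : V -> W) : Prop :=
  forall k, Ck k g.

(* Jacobian: we use the library's derive.jacobian ('J f p = lin1_mx ('d f p)),
   which, acting on row vectors, is the TRANSPOSE of the usual Jacobian;
   the symmetric part is transpose-invariant, so the condition is unchanged. *)

Definition sympart {R : fieldType} (m : nat) (M : 'M[R]_m) : 'M[R]_m :=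
  2^-1 *: (M + M^T).

Definition psd {R : numDomainType} (m : nat) (M : 'M[R]_m) : Prop :=
  forall v : 'cV[R]_m, 0 <= (v^T *m M *m v) 0 0.
Definition loewner_le {R : numDomainType} (m : nat) (M N : 'M[R]_m) : Prop :=
  psd (N - M).

(* Psi(Y, x): Y in R^{nN} stored as a row vector (mxvec of the N x n matrix
   whose k-th row is y_k); the k-th n-block of Psi is Phi(y_k,...,y_{k+N-1}, x). *)
Definition Psi {R : Type} (N n : nat)
  (Phi : 'M[R]_(N, n) -> 'M[R]_(N, n) -> 'rV[R]_n)
  (Y : 'rV[R]_(N * n)) (X : 'M[R]_(N, n)) : 'rV[R]_(N * n) :=
  mxvec (\matrix_(k < N) Phi (cyc k (vec_mx Y)) X).

(* Main.v *)
Require Import Defs.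
From HB Require Import structures.
From mathcomp Require Import all_boot all_order all_algebra.
From mathcomp Require Import all_classical all_reals all_analysis.
From mathcomp Require Import ring lra.
Import Order.TTheory GRing.Theory Num.Theory.
Import numFieldNormedType.Exports.
Local Open Scope ring_scope.
Local Open Scope classical_set_scope.

(** Since [Phi (cyc i X) X = f (row i X) + u i X], the state [x] and each of its
    cyclic shifts [cyc k x] solve the same non-autonomous equation
    [Y' = Psi Y (x t)].  The bound on the symmetric part of the Jacobian makes
    [Psi] one-sided Lipschitz with constant [- lambda], so the squared
    Euclidean distance between these two solutions decays like
    [expR (- 2 lambda t)]; the block [j] of their difference is
    [x_j - x_{j+k}].  [smooth] only speaks of directional derivatives, whereas
    [jacobian] is junk unless the map is Frechet differentiable: that is
    recovered from the continuity of the partial derivatives. *)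

(** * Calculus along a line *)

Lemma is_derive_line (R : numFieldType) (V W : normedModType R) (g : V -> W)
    (a v : V) (s : R) :
  derivable g (s *: v + a) v ->
  is_derive s 1 (fun r : R => g (r *: v + a)) ('D_v g (s *: v + a)).
Proof.
pose l (r : R) := g (r *: v + a).
have E : (fun h : R => h^-1 *: ((l \o shift s) (h *: 1) - l s)) =
    (fun h : R => h^-1 *: ((g \o shift (s *: v + a)) (h *: v) - l s)).
  by apply/funext => h; rewrite /l /= [h%:A]mulr1 scalerDl addrA.
by move=> dg; split; rewrite /derivable /derive E.
Qed.

(** The increment is reparametrised by [s * h] with [s] in [[0, 1]], so a single application of the
    mean value theorem covers [h] of either sign and [h = 0]. *)
Lemma mean_value_line (R : realType) (V : normedModType R) (g : V -> R)
    (a v : V) (h : R) :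
  (forall x, derivable g x v) ->
  exists2 th : R, 0 <= th <= 1 &
    g (h *: v + a) - g a = h * 'D_v g ((th * h) *: v + a).
Proof.
move=> dg.
pose psi (r : R) := g (r *: v + a).
pose phi (s : R) := psi (s * h).
have dpsi (r : R) : is_derive r 1 psi ('D_v g (r *: v + a)).
  exact: is_derive_line.
have dphi (s : R) : is_derive s 1 phi (h * 'D_v g ((s * h) *: v + a)).
  have dm : is_derive s (1 : R) (fun s : R => s * h) h.
    have -> : (fun s : R => s * h) = h *: (@id R).
      by apply/funext => r; rewrite /= mulrC.
    apply: is_derive_eq; exact: mulr1.
  have := @is_derive1_comp R psi (fun s : R => s * h) s _ _ (dpsi (s * h)) dm.
  by move=> H; apply: is_derive_eq; rewrite mulrC.
have cphi : {within `[0, 1], continuous phi}.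
  by apply: derivable_within_continuous => s _; exact: ex_derive.
have [th] := @MVT_segment R phi _ 0 1 ler01 (fun s _ => dphi s) cphi.
rewrite in_itv/= => th01 E; exists th => //; move: E.
by rewrite /phi /psi !(mul1r, mul0r, scale0r, add0r, subr0, mulr1).
Qed.

(** * Frechet differentiability from continuous partial derivatives *)

Lemma entry_le_mx_norm (R : realType) (m n : nat) (A : 'M[R]_(m, n)) i j :
  `|A i j| <= `|A|.
Proof.
rewrite [leRHS]/Num.Def.normr/= mx_normrE.
by apply: le_trans; last exact: (le_bigmax _ _ (i, j)).
Qed.

Lemma mx_norm_le (R : realType) (m n : nat) (A : 'M[R]_(m, n)) (c : R) :
  0 <= c -> (forall i j, `|A i j| <= c) -> `|A| <= c.
Proof.
by move=> c0 Ac; rewrite /Num.Def.normr/= mx_normrE (bigmax_le _ c0).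
Qed.

(** The estimate is a first-order expansion with error o(h); uniqueness of the differential then
    identifies [df] with ['d f a]. *)
Lemma differentiable_linear_approx (R : numFieldType) (V W : normedModType R)
    (f : V -> W) (df : {linear V -> W}) (a : V) :
  continuous df ->
  (forall eps : R, 0 < eps ->
    \forall h \near 0, `|f (h + a) - (f a + df h)| <= eps * `|h|) ->
  differentiable f a.
Proof.
move=> dfc fo.
have ho : f \o shift a = cst (f a) + df +o_ 0 id by exact/eqaddoP.
by apply/diff_locallyP; rewrite (diff_unique dfc ho).
Qed.

(** The increment from [a] to [h + a] telescopes into moves along coordinate axes; on each, the mean
    value theorem yields a partial derivative at a point near [a], which continuity compares with
    its value at [a]. *)
Lemma differentiable_continuous_partials (R : realType) (m : nat)
    (g : 'rV[R]_m -> R) (a : 'rV[R]_m) :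
  (forall i x, derivable g x (delta_mx 0 i)) ->
  (forall i, {for a, continuous ('D_(delta_mx 0 i) g)}) ->
  differentiable g a.
Proof.
move=> dg cg.
pose df (h : 'rV[R]_m) := \sum_i h 0 i * 'D_(delta_mx 0 i) g a.
have dflin : linear df.
  move=> c u v; rewrite /df scaler_sumr -big_split/=; apply: eq_bigr => i _.
  by rewrite !mxE mulrDl [_ *: _]mulrA.
pose dfL : {linear 'rV[R]_m -> R} :=
  HB.pack df (GRing.isLinear.Build _ _ _ _ _ dflin).
have dfc : continuous df.
  apply: continuous_big => [|i _ h]; first exact: add_continuous.
  exact: (@continuousM R 'rV[R]_m (fun x => x 0 i) (cst _) h
    (@coord_continuous R 1 m 0 i h) (@cst_continuous _ _ _ h)).
apply: (@differentiable_linear_approx _ _ _ g dfL _ dfc) => eps eps0.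
(* [tr k h] keeps the first [k] coordinates of [h], so that consecutive points
   [tr k h + a] differ along one coordinate axis only. *)
pose tr (k : nat) (h : 'rV[R]_m) : 'rV[R]_m :=
  \row_(i < m) (if (i < k)%N then h 0 i else 0).
have trS (k : 'I_m) h : tr k.+1 h = h 0 k *: delta_mx 0 k + tr k h.
  apply/rowP => i; rewrite !mxE eqxx/= ltnS leq_eqVlt.
  have [ik|] := eqVneq i k; first by rewrite ik eqxx ltnn mulr1 addr0.
  by move=> ik; rewrite (negbTE (ik : (i : nat) != k)) mulr0 add0r.
(* The [m] moves each cost this fraction of [eps]; [m.+1] keeps the quotient meaningful when
   [m = 0]. *)
have e0 : 0 < eps / m.+1%:R by rewrite divr_gt0.
have : \forall y \near a, forall i,
    `|'D_(delta_mx 0 i) g a - 'D_(delta_mx 0 i) g y| <= eps / m.+1%:R.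
  apply: (@filter_forall _ _ _ _ (nbhs_filter a)) => i.
  by have /cvgrPdist_le := cg i; exact.
move=> /nbhs_ballP[d /= d0 cd].
apply/nbhs_ballP; exists d => //= h.
rewrite -ball_normE/= sub0r normrN => hd.
have step (k : 'I_m) :
  `|(g (tr k.+1 h + a) - g (tr k h + a)) - h 0 k * 'D_(delta_mx 0 k) g a|
    <= eps / m.+1%:R * `|h|.
  have [th th01 E] := mean_value_line _ _ g (tr k h + a) _ (h 0 k) (dg k).
  have -> : tr k.+1 h + a = h 0 k *: delta_mx 0 k + (tr k h + a).
    by rewrite trS addrA.
  rewrite E.
  rewrite -mulrBr normrM mulrC ler_pM ?entry_le_mx_norm// distrC.
  apply: cd; rewrite -ball_normE/=; apply: le_lt_trans hd.
  (* In the sup norm the intermediate point stays within [|h|] of [a]: [tr k h] vanishes at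
     coordinate [k], so no coordinate receives two contributions. *)
  rewrite distrC addrA addrK.
  apply: mx_norm_le => // i j; rewrite !mxE (ord1 i)/=.
  have [->|jk] := eqVneq j k.
    rewrite ltnn mulr1 addr0 normrM; apply: le_trans (entry_le_mx_norm _ _ _ _ 0 k).
    rewrite ler_piMl// ger0_norm; by case/andP: th01.
  rewrite mulr0 add0r; case: ifP => _; first exact: entry_le_mx_norm.
  by rewrite normr0.
have trm : tr m h = h by apply/rowP => i; rewrite mxE ltn_ord.
have tr0 : tr 0 h = 0 by apply/rowP => i; rewrite !mxE.
rewrite -[X in `|X|]/(g (h + a) - (g a + df h)).
have -> : g (h + a) - (g a + df h) =
  \sum_(k < m) ((g (tr k.+1 h + a) - g (tr k h + a)) - h 0 k * 'D_(delta_mx 0 k) g a).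
  rewrite sumrB -(big_mkord xpredT (fun k => g (tr k.+1 h + a) - g (tr k h + a))).
  by rewrite telescope_sumr// trm tr0 add0r opprD addrA.
apply: le_trans (ler_norm_sum _ _ _) _.
apply: le_trans (ler_sum _ (fun k _ => step k)) _.
rewrite sumr_const card_ord -[leLHS]mulr_natl mulrA ler_wpM2r// mulrCA ler_piMr ?(ltW eps0)//.
by rewrite ler_pdivrMr// mul1r ler_nat.
Qed.

Lemma differentiable_entries (R : realType) (V : normedModType R) (m : nat)
    (F : V -> 'rV[R]_m) (a : V) :
  (forall j, differentiable (fun x => F x 0 j) a) -> differentiable F a.
Proof.
move=> dF.
have -> : F = \sum_(j < m) (fun x => F x 0 j *: delta_mx 0 j).
  by apply/funext => x; rewrite fct_sumE -row_sum_delta.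
by apply: differentiable_sum => j; exact: differentiableZl.
Qed.

(** A general [V] has no coordinates, so [F] is pulled back along an affine map from a row space:
    the [i]-th partial derivative is then the derivative of [F] in the direction [L (delta_mx 0 i)],
    continuous by [Ck 1]. *)
Lemma Ck1_row_differentiable (R : realType) (V : normedModType R) (m n : nat)
    (F : V -> 'rV[R]_n) (L : 'rV[R]_m -> V) (b : V) (Y : 'rV[R]_m) :
  Ck 1 F -> linear L -> continuous L ->
  differentiable (fun Z => F (L Z + b)) Y.
Proof.
move=> [dF cF] linL cL; apply: differentiable_entries => j.
pose g (Z : 'rV[R]_m) := F (L Z + b) 0 j.
have dg v Z : is_derive Z v g ('D_(L v) F (L Z + b) 0 j).
  have : is_derive (L Z + b) (L v) (fun z => F z 0 j) ('D_(L v) F (L Z + b) 0 j).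
    split; first by have /derivable_mxP := dF (L Z + b) (L v); exact.
    by rewrite derive_mx ?mxE.
  have E : (fun h : R => h^-1 *: ((g \o shift Z) (h *: v) - g Z)) =
      (fun h : R => h^-1 *: (((fun z => F z 0 j) \o shift (L Z + b)) (h *: L v)
                             - F (L Z + b) 0 j)).
    by apply/funext => h; rewrite /g /= linL addrA.
  by case=> d1 d2; split; rewrite /derivable /derive E.
apply: differentiable_continuous_partials => [i Z|i]; first exact: ex_derive.
have -> : 'D_(delta_mx 0 i) g = fun Z => 'D_(L (delta_mx 0 i)) F (L Z + b) 0 j.
  by apply/funext => Z; rewrite derive_val.
have cLb : {for Y, continuous (fun Z => L Z + b)}.
  exact: (continuousD (cL Y) (@cst_continuous _ _ b Y)).
have cD := @continuous_comp _ _ _ _ _ _ cLb (cF (L (delta_mx 0 i)) (L Y + b)).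
exact: (@continuous_comp _ _ _ _ (fun M : 'rV[R]_n => M 0 j) _ cD
  (@coord_continuous R 1 n 0 j _)).
Qed.

Lemma linear_norm_le_continuous (R : numFieldType) (V W : normedModType R)
    (L : V -> W) :
  linear L -> (forall v, `|L v| <= `|v|) -> continuous L.
Proof.
move=> linL L1 x; apply/cvgrPdist_lt => e e0.
apply/nbhs_ballP; exists e => //= y; rewrite -ball_normE/= => xy.
apply: le_lt_trans xy; apply: le_trans (L1 _).
by rewrite [x - y]addrC -[- y]scaleN1r linL scaleN1r addrC.
Qed.

Lemma differentiable_Psi (R : realType) (n N : nat)
    (Phi : 'M[R]_(N, n) -> 'M[R]_(N, n) -> 'rV[R]_n)
    (X : 'M[R]_(N, n)) (Y : 'rV[R]_(N * n)) :
  Ck 1 (fun p : 'M[R]_(N, n) * 'M[R]_(N, n) => Phi p.1 p.2) ->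
  differentiable (fun Z => Psi Phi Z X) Y.
Proof.
move=> CPhi; apply: differentiable_entries => l.
case/mxvec_indexP: l => k j.
pose L (Z : 'rV[R]_(N * n)) : 'M[R]_(N, n) * 'M[R]_(N, n) :=
  (cyc k (vec_mx Z), 0).
have linL : linear L.
  move=> c u v.
  rewrite /L -[RHS]/(c *: cyc k (vec_mx u) + cyc k (vec_mx v), c *: 0 + 0).
  rewrite scaler0 addr0; congr pair.
  by apply/matrixP => i i'; rewrite !mxE.
have cL : continuous L.
  apply: linear_norm_le_continuous => // v.
  rewrite [leLHS]/Num.Def.normr/= ge_max normr0 normr_ge0 andbT.
  by apply: mx_norm_le => // i i'; rewrite !mxE; exact: entry_le_mx_norm.
have := Ck1_row_differentiable _ _ _ _ _ L (0, X) Y CPhi linL cL.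
move=> /(differentiable_comp (f := fun Z => _)) /(_ (differentiable_coord _ 0 j)).
rewrite /comp /=.
have -> // : (fun Z => Psi Phi Z X 0 (mxvec_index k j)) =
   (fun Z : 'rV[R]_(N * n) => Phi (cyc k (vec_mx Z) + 0) (0 + X) 0 j).
by apply/funext => Z; rewrite /Psi mxvecE mxE addr0 add0r.
Qed.

(** * Contraction estimates *)

Lemma one_sided_lipschitz (R : realType) (m : nat) (F : 'rV[R]_m -> 'rV[R]_m)
    (lambda : R) (Y Z : 'rV[R]_m) :
  (forall X, differentiable F X) ->
  (forall X, loewner_le (sympart (jacobian F X)) (- lambda *: 1%:M)) ->
  \sum_i (F Y - F Z) 0 i * (Y - Z) 0 i <= - lambda * \sum_i (Y - Z) 0 i ^+ 2.
Proof.
move=> dF HF; pose D : 'rV[R]_m := Y - Z; rewrite -/D.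
have DZ : D + Z = Y by rewrite subrK.
clearbody D.
(* Pairing [F] with the fixed vector [D] gives a scalar function, to which the mean value theorem
   applies on the segment from [Z] to [Y]. *)
pose g (X : 'rV[R]_m) := \sum_i F X 0 i * D 0 i.
have dg X : is_derive X D g ((D *m jacobian F X *m D^T) 0 0).
  have dFi i : is_derive X D (fun X => F X 0 i) ((D *m jacobian F X) 0 i).
    have dFX : derivable F X D by exact: diff_derivable.
    split; first by move/derivable_mxP : dFX; exact.
    by rewrite -deriveEjacobian// derive_mx ?mxE.
  have -> : g = \sum_i (D 0 i \*: (fun X => F X 0 i)).
    by apply/funext => X'; rewrite fct_sumE; apply: eq_bigr => i _; rewrite mulrC.
  apply: is_derive_eq; rewrite mxE; apply: eq_bigr => i _.
  by rewrite [D^T _ _]mxE mulrC.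
have dgX X : derivable g X D by exact: ex_derive.
have [th _] := mean_value_line _ _ g Z D 1 dgX.
rewrite scale1r DZ derive_val mul1r.
have -> : g Y - g Z = \sum_i (F Y - F Z) 0 i * D 0 i.
  by rewrite /g -sumrB; apply: eq_bigr => i _; rewrite !mxE mulrBl.
move=> ->.
have := HF (th * 1 *: D + Z) D^T.
set J := jacobian _ _.
have -> : (D^T^T *m (- lambda *: 1%:M - sympart J) *m D^T) 0 0 =
   - lambda * (\sum_i D 0 i ^+ 2) - (D *m J *m D^T) 0 0.
  rewrite trmxK mulmxBr mulmxBl -scalemxAr mulmx1 -scalemxAl.
  rewrite [LHS]mxE [X in X + _]mxE [X in _ + X]mxE; congr (_ * _ - _).
    by rewrite mxE; apply: eq_bigr => i _; rewrite mxE expr2.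
  rewrite /sympart -scalemxAr -scalemxAl mulmxDr mulmxDl mxE [X in _ * X]mxE.
  (* A 1 x 1 matrix is its own transpose, so [J] and its symmetric part have the same quadratic
     form. *)
  have -> : (D *m J^T *m D^T) 0 0 = (D *m J *m D^T) 0 0.
    have -> : D *m J^T *m D^T = (D *m J *m D^T)^T.
      by rewrite !trmx_mul trmxK mulmxA.
    by rewrite mxE.
  by field.
by rewrite subr_ge0.
Qed.

(** The integrating factor [expR (c * t)] turns [E] into a function [W] with nonpositive derivative
    for [t > 0]; right continuity at 0 lets the comparison start there. *)
Lemma gronwall_decay (R : realType) (E : R -> R) (c : R) :
  E t @[t --> 0^'+] --> E 0 ->
  (forall t : R, 0 < t -> exists2 dE : R, is_derive t 1 E dE & dE <= - c * E t) ->
  forall t : R, 0 <= t -> E t <= E 0 * expR (- c * t).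
Proof.
move=> E0 dE t t0.
pose W (s : R) := E s * expR (c * s).
have dexp (s : R) : is_derive s 1 (fun s : R => expR (c * s)) (c * expR (c * s)).
  have dm : is_derive s (1 : R) (fun s : R => c * s) c.
    by have -> : ( *%R c) = c *: (@id R) by []; apply: is_derive_eq; exact: mulr1.
  have H := @is_derive1_comp R expR (fun s : R => c * s) s _ _ (is_derive_expR _) dm.
  by apply: is_derive_eq; rewrite mulrC.
have dW (s : R) : 0 < s -> exists2 dW : R, is_derive s 1 W dW & dW <= 0.
  move=> s0; have [e Ee le] := dE s s0.
  exists (expR (c * s) * (e + c * E s)).
    have -> : W = E * (fun s : R => expR (c * s)) by [].
    by apply: is_derive_eq; rewrite /GRing.scale/=; ring.
  by rewrite pmulr_rle0 ?expR_gt0//; lra.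
have cW : {within `[0, +oo[, continuous W}.
  apply/continuous_within_itvcyP; split.
    move=> s; rewrite in_itv/= andbT => s0.
    apply: differentiable_continuous; apply/derivable1_diffP.
    by have [w dw _] := dW s s0; exact: ex_derive.
  apply: cvgM => //; apply: cvg_at_right_filter.
  suff : {for 0, continuous (fun s : R => expR (c * s))} by [].
  by apply: differentiable_continuous; apply/derivable1_diffP.
have := @ler0_derive1_nincry R W 0 _ _ cW 0 t (lexx _) t0.
rewrite /W mulr0 expR0 mulr1 mulNr expRN => H.
rewrite ler_pdivlMr ?expR_gt0//; apply: H => s; rewrite in_itv/= andbT => s0.
  by have [w dw _] := dW s s0; exact: ex_derive.
by have [w dw w0] := dW s s0; rewrite derive1E derive_val.
Qed.

(** The matrix norm is a sup norm, so the energy is an explicit sum of squares: its derivative is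
    twice the pairing bounded by [one_sided_lipschitz], whence the rate [2 * lambda]. *)
Lemma contraction_energy_decay (R : realType) (m : nat)
    (F : R -> 'rV[R]_m -> 'rV[R]_m) (lambda : R) (y z : R -> 'rV[R]_m) :
  (forall t : R, 0 <= t -> forall X, differentiable (F t) X) ->
  (forall t : R, 0 <= t -> forall X,
    loewner_le (sympart (jacobian (F t) X)) (- lambda *: 1%:M)) ->
  (forall i, y t 0 i @[t --> 0^'+] --> y 0 0 i) ->
  (forall i, z t 0 i @[t --> 0^'+] --> z 0 0 i) ->
  (forall t : R, 0 < t -> forall i, is_derive t 1 (fun s => y s 0 i) (F t (y t) 0 i)) ->
  (forall t : R, 0 < t -> forall i, is_derive t 1 (fun s => z s 0 i) (F t (z t) 0 i)) ->
  forall t : R, 0 <= t ->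
    \sum_i (y t - z t) 0 i ^+ 2 <=
    (\sum_i (y 0 - z 0) 0 i ^+ 2) * expR (- (2 * lambda) * t).
Proof.
move=> dF HF y0 z0 dy dz.
apply: (@gronwall_decay R (fun t => \sum_i (y t - z t) 0 i ^+ 2)).
  apply: cvg_big => [|i _]; first exact: add_continuous.
  under eq_fun do rewrite !mxE expr2.
  by rewrite !mxE expr2; apply: cvgM; apply: cvgB; rewrite ?y0 ?z0.
move=> t t0.
exists (2 * \sum_i (F t (y t) - F t (z t)) 0 i * (y t - z t) 0 i).
  have -> : (fun s => \sum_i (y s - z s) 0 i ^+ 2) =
      \sum_i (((fun s => y s 0 i) - (fun s => z s 0 i)) ^+ 2).
    apply/funext => s; rewrite fct_sumE; apply: eq_bigr => i _.
    by rewrite !mxE.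
  have dyi := dy t t0; have dzi := dz t t0.
  apply: is_derive_eq; rewrite mulr_sumr; apply: eq_bigr => i _.
  by rewrite !mxE /GRing.scale/= expr1 -mulrA [X in _ * X]mulrC.
rewrite -mulrN -mulrA ler_pM2l//.
by apply: one_sided_lipschitz => X; [apply: dF|apply: HF]; exact: ltW.
Qed.

(** * Cyclic shifts and synchronization *)

Lemma cshiftA (N : nat) (k i a : 'I_N) :
  cshift k (cshift i a) = cshift (cshift k i) a.
Proof. by apply/val_inj; rewrite /= modnDmr modnDml addnA. Qed.

Lemma cshift_onto (N : nat) (i j : 'I_N) : exists k : 'I_N, cshift k j = i.
Proof.
have N0 : (0 < N)%N by exact: leq_ltn_trans (leq0n i) (ltn_ord i).
(* The witness is [i - j] modulo [N], written so that the natural subtraction does not truncate. *)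
exists (Ordinal (ltn_pmod (i + (N - j)) N0)); apply/val_inj => /=.
by rewrite modnDml -addnA subnK ?modnDr ?modn_small // ltnW.
Qed.

Lemma cyc_cyc (R : Type) (N n : nat) (k i : 'I_N) (X : 'M[R]_(N, n)) :
  cyc i (cyc k X) = cyc (cshift k i) X.
Proof. by apply/matrixP => a j; rewrite !mxE cshiftA. Qed.

Theorem theorem3p5 (R : realType) (n N : nat)
  (f : 'rV[R]_n -> 'rV[R]_n)
  (u : 'I_N -> 'M[R]_(N, n) -> 'rV[R]_n)
  (Phi : 'M[R]_(N, n) -> 'M[R]_(N, n) -> 'rV[R]_n)
  (HPhi_smooth : smooth (fun p : 'M[R]_(N, n) * 'M[R]_(N, n) => Phi p.1 p.2))
  (HPhi : forall (i : 'I_N) (X : 'M[R]_(N, n)),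
      Phi (cyc i X) X = f (row i X) + u i X)
  (x : R -> 'M[R]_(N, n))
  (Hx0 : x t @[t --> 0^'+] --> x 0)
  (Hsol : forall t : R, 0 < t ->
      derivable x t 1 /\
      'D_1 x t = \matrix_(i < N) (f (row i (x t)) + u i (x t)))
  (lambda : R) (Hlambda : 0 < lambda)
  (Hcontr : forall (Y : 'rV[R]_(N * n)) (t : R), 0 <= t ->
      loewner_le (sympart (jacobian (fun Z => Psi Phi Z (x t)) Y))
                 (- lambda *: 1%:M)) :
  exists C c : R, 0 < c /\
    forall (t : R), 0 <= t -> forall i j : 'I_N,
      `| row i (x t) - row j (x t) | <= C * expR (- c * t).
Proof.
pose y (t : R) := mxvec (x t); pose z k (t : R) := mxvec (cyc k (x t)).
pose F (t : R) Y := Psi Phi Y (x t).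
have yE (t : R) i j : y t 0 (mxvec_index i j) = x t i j by rewrite /y mxvecE.
have zE k (t : R) i j : z k t 0 (mxvec_index i j) = x t (cshift k i) j.
  by rewrite /z mxvecE mxE.
have FE (t : R) (X : 'M[R]_(N, n)) i j :
    F t (mxvec X) 0 (mxvec_index i j) = Phi (cyc i X) (x t) 0 j.
  by rewrite /F /Psi mxvecK mxvecE mxE.
have dx (t : R) : 0 < t -> forall i j,
    is_derive t 1 (fun s => x s i j) (Phi (cyc i (x t)) (x t) 0 j).
  move=> t0 i j; have [dxt xt] := Hsol t t0; split.
    by move/derivable_mxP : dxt; exact.
  by rewrite HPhi; move: xt; rewrite derive_mx// => /matrixP/(_ i j); rewrite !mxE.
have x0 i j : x t i j @[t --> 0^'+] --> x 0 i j.
  exact: (cvg_comp _ _ Hx0 (@coord_continuous R N n i j (x 0))).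
pose E k (t : R) := \sum_l (y t - z k t) 0 l ^+ 2.
have decay k (t : R) : 0 <= t -> E k t <= E k 0 * expR (- (2 * lambda) * t).
  apply: (@contraction_energy_decay R (N * n) F lambda y (z k)).
  - by move=> s _ X; apply: differentiable_Psi; exact: HPhi_smooth.
  - by move=> s s0 X; exact: Hcontr.
  - by case/mxvec_indexP => i j; rewrite yE; under eq_fun do rewrite yE; exact: x0.
  - by case/mxvec_indexP => i j; rewrite zE; under eq_fun do rewrite zE; exact: x0.
  - move=> s s0; case/mxvec_indexP => i j; rewrite FE.
    by under eq_fun do rewrite yE; exact: dx.
  (* Block [i] of [F] at the shifted state is [Phi] at shift [k + i], the velocity of node [k + i]
     in the unshifted network. *)
  - move=> s s0; case/mxvec_indexP => i j; rewrite FE cyc_cyc.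
    by under eq_fun do rewrite zE; exact: dx.
(* Summing over all shifts makes the constant independent of [i] and [j]; the square root halves the
   rate [2 * lambda]. *)
exists (\sum_k Num.sqrt (E k 0)), lambda; split=> // t t0 i j.
have [k kj] := cshift_onto _ i j.
have Ek0 : Num.sqrt (E k 0) <= \sum_k Num.sqrt (E k 0).
  by rewrite (bigD1 k)//= lerDl sumr_ge0// => ? _; exact: sqrtr_ge0.
apply: (@le_trans _ _ (Num.sqrt (E k 0) * expR (- lambda * t))); last first.
  by rewrite ler_wpM2r// expR_ge0.
apply: mx_norm_le => [|r l]; first by rewrite mulr_ge0 ?sqrtr_ge0 ?expR_ge0.
rewrite !mxE -kj -sqrtr_sqr -[expR _]ger0_norm ?expR_ge0// -sqrtr_sqr.
rewrite -sqrtrM; last by apply: sumr_ge0 => ? _; exact: sqr_ge0.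
apply: ler_wsqrtr; rewrite -expRM_natl.
have -> : 2 * (- lambda * t) = - (2 * lambda) * t by ring.
apply: le_trans (decay k t t0).
(* As [k + j = i], the squared entry is, after a sign change, the term of [E k t] at block [j]. *)
rewrite /E (bigD1 (mxvec_index j l))//= mxE [X in (_ + X) ^+ 2 + _]mxE yE zE.
rewrite -sqrrN opprB lerDl; apply: sumr_ge0 => ? _; exact: sqr_ge0.
Qed.
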